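(* Let $W=(W_t)_{t\ge0}$ be a standard Brownian motion and let $f=(f(t,x),\ t\ge 0,\ x\in\mathbb{R})$ be a strictly positive (real-)analytic function on $[0,\infty)\times\mathbb{R}$ satisfying $$f^2(t,W_t)=f(4t,\,2W_t+t)\qquad P\text{-a.s., for each } t\ge 0.$$ Then there is a constant $c\in\mathbb{R}$ such that $$f(t,x)=e^{cx-\frac{c}{2}t}\qquad\text{for all } t\ge 0,\ x\in\mathbb{R}.$$
   Context: Here $f^2(t,x)$ denotes $(f(t,x))^2$. Analyticity is on $[0,\infty)\times\mathbb{R}$ including the boundary $t=0$, i.e. $f$ is the restriction of a real-analytic function defined on an open neighbourhood of $[0,\infty)\times\mathbb{R}$ in $\mathbb{R}^2$. *)

(* Defs.v *)
From HB Require Import structures.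
From mathcomp Require Import all_boot all_order all_algebra.
From mathcomp Require Import all_classical all_reals all_analysis.

Set Implicit Arguments.
Unset Strict Implicit.
Unset Printing Implicit Defensive.

Import Order.TTheory GRing.Theory Num.Theory.
Import numFieldNormedType.Exports.

Local Open Scope classical_set_scope.
Local Open Scope ring_scope.

Definition mutually_independent (d : measure_display) (T : measurableType d)
    (R : realType) (P : probability T R) (I : finType)
    (X : I -> T -> R) : Prop :=
  forall B : I -> set R, (forall i, measurable (B i)) ->
    P (\bigcap_(i in [set: I]) (X i @^-1` B i)) =
    (\prod_(i : I) P (X i @^-1` B i))%E.

(* The process is indexed by all of [R], but only its values at times [t >= 0]
   are constrained. The second parameter of [normal_prob] is the standard
   deviation; it is only used here when it is nonzero. *)
Record standard_brownian_motion (d : measure_display) (T : measurableType d)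
    (R : realType) (P : probability T R) (W : R -> {RV P >-> R}) : Prop :=
  StandardBrownianMotion {
    bm_start : {ae P, forall w, W 0 w = 0} ;
    bm_independent_increments : forall (n : nat) (t : nat -> R),
      0 <= t 0%N -> {homo t : i j / (i <= j)%N >-> i <= j} ->
      mutually_independent P
        (fun i : 'I_n => W (t i.+1) \- W (t i)) ;
    bm_gaussian_increments : forall s t : R, 0 <= s -> s < t ->
      forall B : set R, measurable B ->
        pushforward P (W t \- W s) B =
        normal_prob 0 (Num.sqrt (t - s)) B ;
    bm_continuous_paths :
      {ae P, forall w, {within `[0, +oo[, continuous (fun t : R => W t w)}}
  }.

Arguments standard_brownian_motion {d T R} P W.

(* Near every point of [U], [F] is the sum of an absolutely convergent double
   power series. Absolute convergence makes the order of summation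
   irrelevant, so the sum is given by the square partial sums. *)
Definition real_analytic2 (R : realType) (U : set (R * R)) (F : R * R -> R) :
    Prop :=
  forall p : R * R, U p ->
    exists (a : nat -> nat -> R) (r : R), 0 < r /\
      forall q : R * R, `|q.1 - p.1| < r -> `|q.2 - p.2| < r ->
        let term (i j : nat) := a i j * (q.1 - p.1) ^+ i * (q.2 - p.2) ^+ j in
        summable [set: nat * nat] (fun ij => (term ij.1 ij.2)%:E) /\
        (fun n : nat => \sum_(i < n) \sum_(j < n) term i j) @ \oo --> F q.

(* Analyticity on a set that need not be open, such as a closed half-plane. *)
Definition analytic2_on (R : realType) (A : set (R * R)) (f : R * R -> R) :
    Prop :=
  exists (U : set (R * R)) (F : R * R -> R),
    [/\ open U, A `<=` U, real_analytic2 U F & forall p, A p -> F p = f p].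

(* Main.v *)
(** For t > 0 the law of W_t charges every open interval, so continuity turns
    the almost sure identity into f(t, x)^2 = f(4t, 2x + t) for all x. In the
    coordinate u = x - t/2 the map (t, x) |-> (4t, 2x + t) becomes
    (t, u) |-> (4t, 2u), whence ln f(t, x) is 2^n times the value of ln f at the
    point with time t / 4^n and coordinate u / 2^n. Since f(0, 0) = 1, only the
    first-order expansion of f at the origin survives as n tends to infinity,
    and it gives ln f(t, x) = c u with c the x-derivative of f at (0, 0). The
    boundary t = 0 follows by continuity. *)

Require Import Defs.
From HB Require Import structures.
From mathcomp Require Import all_boot all_order all_algebra.
From mathcomp Require Import all_classical all_reals all_analysis.
From mathcomp Require Import measurable_realfun ring lra.

Set Implicit Arguments.
Unset Strict Implicit.
Unset Printing Implicit Defensive.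

Import Order.TTheory GRing.Theory Num.Theory.
Import numFieldNormedType.Exports.

Local Open Scope classical_set_scope.
Local Open Scope ring_scope.

(** * First-order expansion of a double power series *)

(** Each square is a finite subfamily of the index set, so the total sum of absolute values, finite
    by summability, serves as [S]. *)
Lemma summable_square_sum_le (R : realType) (u : nat -> nat -> R) :
  summable [set: nat * nat] (fun ij => (u ij.1 ij.2)%:E) ->
  exists2 S : R, 0 <= S & forall n,
    \sum_(i < n) \sum_(j < n) `|u i j| <= S.
Proof.
rewrite summableE => fin.
have leS n : ((\sum_(i < n) \sum_(j < n) `|u i j|)%:E <=
    \esum_(ij in [set: nat * nat]) `|(u ij.1 ij.2)%:E|)%E.
  apply: esum_ge.
  pose r := [seq (i, j) | i <- index_iota 0 n, j <- index_iota 0 n].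
  exists [set` r]; first by split=> //; exact: finite_seq.
  rewrite -fsbig_seq; last first.
    by apply: allpairs_uniq; rewrite ?iota_uniq// => -[a b] [c e].
  rewrite big_allpairs/= -sumEFin big_mkord.
  by apply: lee_sum => i _; rewrite -sumEFin big_mkord.
exists (fine (\esum_(ij in [set: nat * nat]) `|(u ij.1 ij.2)%:E|)%E).
  by rewrite fine_ge0// esum_ge0.
by move=> n; rewrite -lee_fin fineK.
Qed.

Lemma squeeze_dist0 (R : realType) (T : Type) (F : set_system T)
    (FF : Filter F) (g e : T -> R) (l : R) :
  (\forall x \near F, `|g x - l| <= e x) -> e @ F --> 0 -> g @ F --> l.
Proof.
move=> ge e0; apply/cvgrPdistC_le => eps eps0.
near=> x; apply: (@le_trans _ _ (e x)).
  by near: x.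
by near: x; exact: (cvgr_le _ e0).
Unshelve. all: by end_near.
Qed.

(* At the half radius [d] the monomials of degree at least 2 are bounded by
   [`|a i j| * d ^+ (i + j) * (h / d) ^+ 2], a summable family. *)
Lemma real_analytic2_taylor1 (R : realType) (U : set (R * R)) (F : R * R -> R)
    (p : R * R) :
  real_analytic2 U F -> U p ->
  exists a b C r : R, [/\ 0 <= C, 0 < r & forall s v h : R,
    `|s| <= h -> `|v| <= h -> h <= r ->
    `|F (p.1 + s, p.2 + v) - F p - (a * s + b * v)| <= C * h ^+ 2].
Proof.
move=> FU Up; have [a [r [r0 FE]]] := FU _ Up.
have {}FE s v : `|s| < r -> `|v| < r ->
    summable [set: nat * nat]
      (fun ij => (a ij.1 ij.2 * s ^+ ij.1 * v ^+ ij.2)%:E) /\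
    (fun n : nat => \sum_(i < n) \sum_(j < n) (a i j * s ^+ i * v ^+ j)) @ \oo
      --> F (p.1 + s, p.2 + v).
  have addK (x y : R) : x + y - x = y by rewrite addrAC subrr add0r.
  by have := FE (p.1 + s, p.2 + v); rewrite /= !addK.
pose d := r / 2; have d0 : 0 < d by rewrite divr_gt0.
have dr : d < r by rewrite /d; lra.
have := FE d d; rewrite gtr0_norm// => /(_ dr dr)[+ _].
case/(@summable_square_sum_le _ (fun i j => a i j * d ^+ i * d ^+ j)) => S S0 leS.
have taylor s v h : `|s| <= h -> `|v| <= h -> h <= d ->
    `|F (p.1 + s, p.2 + v) - (a 0%N 0%N + (a 1%N 0%N * s + a 0%N 1%N * v))|
      <= S / d ^+ 2 * h ^+ 2.
  move=> sh vh hd.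
  have h0 : 0 <= h by exact: le_trans sh.
  have [_] := FE s v (le_lt_trans (le_trans sh hd) dr)
                     (le_lt_trans (le_trans vh hd) dr).
  set L := _ + (_ + _); set G := fun n : nat => _ => cvG.
  (* The shift by 2 ensures that every square contains the indices 0 and 1, hence all terms of
     [L]. *)
  have cvH : (fun n => `|G n.+2 - L|) @ \oo --> `|F (p.1 + s, p.2 + v) - L|.
    apply: cvg_norm; apply: cvgB; last exact: cvg_cst.
    by move: cvG; rewrite -(cvg_shiftn 2)/=; under eq_fun do rewrite addn2.
  apply: (cvgr_to_le cvH); near=> n.
  (* Written as a square sum of its truncated terms, [L] can be subtracted term by term, which
     leaves only the monomials of degree at least 2. *)
  pose lin (i j : nat) := if (i + j < 2)%N then a i j * s ^+ i * v ^+ j else 0.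
  have -> : L = \sum_(i < n.+2) \sum_(j < n.+2) lin i j.
    have lin0 (i j : nat) : (2 <= i + j)%N -> lin i j = 0.
      by move=> ij; rewrite /lin ltnNge ij.
    rewrite 2!big_ord_recl [X in _ + (_ + X)]big1 ?addr0; last first.
      by move=> i _; apply: big1 => j _; rewrite lin0.
    rewrite 2!big_ord_recl [X in _ + (_ + X) + _]big1 ?addr0; last first.
      by move=> i _; rewrite lin0.
    rewrite big_ord_recl [X in _ = _ + (_ + X)]big1 ?addr0; last first.
      by move=> i _; rewrite lin0.
    by rewrite /L /lin /= !expr0 !expr1 !mulr1 -addrA (addrC (a 1%N _ * _)).
  rewrite -sumrB.
  apply: le_trans (ler_norm_sum _ _ _) _.
  under eq_bigr do rewrite -sumrB.
  apply: (@le_trans _ _ (\sum_(i < n.+2) \sum_(j < n.+2)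
      `|a i j * d ^+ i * d ^+ j| * (h / d) ^+ 2)).
    apply: ler_sum => i _.
    apply: le_trans (ler_norm_sum _ _ _) _.
    apply: ler_sum => j _.
    rewrite /lin; case: ltnP => ij.
      by rewrite subrr normr0 mulr_ge0// exprn_ge0// divr_ge0// ltW.
    rewrite subr0 !normrM !normrX -!mulrA ler_wpM2l// (gtr0_norm d0).
    apply: (@le_trans _ _ (h ^+ i * h ^+ j)).
      by apply: ler_pM; rewrite ?exprn_ge0// lerXn2r// nnegrE.
    rewrite mulrA -!exprD -(subnK ij) exprD.
    rewrite [leRHS](_ : _ = d ^+ (i + j - 2) * h ^+ 2); last first.
      by rewrite exprD; field; rewrite gt_eqF.
    by rewrite ler_wpM2r ?exprn_ge0// lerXn2r// nnegrE// ltW.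
  rewrite -(_ : S * (h / d) ^+ 2 = S / d ^+ 2 * h ^+ 2); last first.
    by field; rewrite gt_eqF.
  under eq_bigr do rewrite -mulr_suml.
  by rewrite -mulr_suml ler_wpM2r// exprn_ge0// divr_ge0// ltW.
(* With [h = 0] the error bound vanishes, which identifies the constant coefficient. *)
have Fp : F p = a 0%N 0%N.
  have := taylor 0 0 0; rewrite normr0 !mulr0 !addr0 expr0n/= mulr0.
  rewrite -surjective_pairing => /(_ (lexx _) (lexx _) (ltW d0)); rewrite normr_le0 subr_eq0.
  by move/eqP.
exists (a 1%N 0%N), (a 0%N 1%N), (S / d ^+ 2), d; split=> //.
  by rewrite divr_ge0// exprn_ge0// ltW.
by move=> s v h sh vh hd; rewrite Fp -addrA -opprD; exact: taylor.
Unshelve. all: by end_near.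
Qed.

(** With [h q] the l1 distance from [q] to [p], the first-order expansion bounds the increment of
    [F] by [(|a| + |b| + C * h q) * h q], which tends to 0. *)
Lemma real_analytic2_continuous (R : realType) (U : set (R * R))
    (F : R * R -> R) (p : R * R) :
  real_analytic2 U F -> U p -> F q @[q --> p] --> F p.
Proof.
move=> FU Up; have [a [b [C [r [C0 r0 taylor]]]]] := real_analytic2_taylor1 FU Up.
pose h (q : R * R) := `|q.1 - p.1| + `|q.2 - p.2|.
have h0 : h q @[q --> p] --> 0.
  rewrite [X in _ --> X](_ : 0 = h p); last by rewrite /h !subrr normr0 addr0.
  apply: cvgD; apply: cvg_norm; apply: cvgB;
    (exact: cvg_fst || exact: cvg_snd || exact: cvg_cst).
apply: (@squeeze_dist0 _ _ _ _ _ (fun q => (`|a| + `|b| + C * h q) * h q)).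
  have : \forall q \near p, h q <= r by exact: (cvgr_le _ h0).
  apply: filterS => q hr.
  have s1 : `|q.1 - p.1| <= h q by rewrite lerDl.
  have s2 : `|q.2 - p.2| <= h q by rewrite lerDr.
  have := taylor _ _ _ s1 s2 hr.
  rewrite !subrKC -surjective_pairing; set E := _ + _ * _ => FE.
  have Eh : `|E| <= (`|a| + `|b|) * h q.
    by rewrite (le_trans (ler_normD _ _))// !normrM mulrDl lerD// ler_wpM2l.
  rewrite -(subrK E (F q - F p)) (le_trans (ler_normD _ _))//.
  by rewrite mulrDl addrC lerD// -mulrA -expr2.
rewrite -(mulr0 (`|a| + `|b| + C * 0)); apply: cvgM => //.
by apply: cvgD; [exact: cvg_cst|apply: cvgM => //; exact: cvg_cst].
Qed.

(** * From almost sure to pointwise identities *)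

(** If the integral were 0, the density would vanish almost everywhere on the interval; being
    positive everywhere, it would force the interval to have Lebesgue measure 0. *)
Lemma normal_prob_itv_gt0 (R : realType) (m s a b : R) : s != 0 -> a < b ->
  (0 < normal_prob m s `]a, b[)%E.
Proof.
move=> s0 ab; rewrite lt0e measure_ge0 andbT; apply/eqP => I0.
have mpdf : measurable_fun (`]a, b[%classic : set R)
    (fun x => (normal_pdf m s x)%:E).
  apply/measurable_EFinP; apply: measurable_funTS; exact: measurable_normal_pdf.
have : (\int[lebesgue_measure]_(x in `]a, b[) `|(normal_pdf m s x)%:E| = 0)%E.
  rewrite -[RHS]I0; apply: eq_integral => x _.
  by rewrite /= ger0_norm// normal_pdf_ge0.
move/(ae_eq_integral_abs lebesgue_measure _ mpdf) => /(_ (measurable_itv _)) Iae.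
have : lebesgue_measure.-negligible (`]a, b[%classic : set R).
  apply: negligibleS Iae => x/= xab; apply/not_implyP; split=> // -[].
  apply/eqP; rewrite normal_pdfE// mulf_neq0//.
    by rewrite gt_eqF// normal_peak_gt0.
  by rewrite gt_eqF// expR_gt0.
move/measure_negligible => /(_ (measurable_itv _)); apply/eqP.
rewrite /= [lebesgue_measure _]lebesgue_measure_itv/= lte_fin ab.
by rewrite -EFinB eqe subr_eq0 gt_eqF.
Qed.

(** If [g] and [h] differ at [x], they differ on a ball around [x] by continuity. The almost sure
    identity then keeps [W t] out of that ball, which has positive Gaussian mass. *)
Lemma brownian_ae_eq_continuous (R : realType) (d : measure_display)
    (T : measurableType d) (P : probability T R) (W : R -> {RV P >-> R})
    (t : R) (g h : R -> R) :
  standard_brownian_motion P W -> 0 < t -> continuous g -> continuous h ->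
  {ae P, forall w, g (W t w) = h (W t w)} -> g =1 h.
Proof.
move=> hW t0 cg ch gh x; apply/eqP/negPn/negP => ghx.
have /nbhs_ballP[e /= e0 xe] : \forall y \near x, g y - h y != 0.
  have cgh : g y - h y @[y --> x] --> g x - h x.
    by apply: cvgB; [exact: cg|exact: ch].
  by apply: (cvgr_neq0 _ cgh); rewrite subr_eq0.
(* The Gaussian law is given for increments only, so the null set where [W 0] may be nonzero is
   added to the one where the identity may fail. *)
have I0 : P ((W t \- W 0) @^-1` `]x - e, x + e[) = 0%E.
  apply: measure_negligible.
    rewrite -[_ @^-1` _]setTI; exact: measurable_funB.
  have [A [mA A0 ghA]] := gh; have [B [mB B0 WB]] := bm_start hW.
  exists (A `|` B); split.
  - exact: measurableU.
  - by apply/null_set_setU.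
  - move=> w /=; have [->|/eqP W0] := eqVneq (W 0 w) 0; last first.
      by move=> _; right; apply: WB.
    rewrite subr0 => Iw; have /xe : ball x e (W t w) by rewrite ball_itv.
    by rewrite subr_eq0 => /eqP ?; left; apply: ghA.
have : (0 < normal_prob 0 (Num.sqrt (t - 0)) `](x - e)%R, (x + e)%R[)%E.
  apply: normal_prob_itv_gt0; first by rewrite subr0 gt_eqF// sqrtr_gt0.
  by rewrite ltrD2l gtrN.
by rewrite -(bm_gaussian_increments hW)// /pushforward I0 ltxx.
Qed.

(** * Dyadic scaling towards the origin *)

(** This is the upper bound [le_ln1Dx] at [- (x / (1 + x))], because [1 - x / (1 + x)] is the
    inverse of [1 + x]. *)
Lemma ge_ln1Dx (R : realType) (x : R) : -1 < x -> x / (1 + x) <= ln (1 + x).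
Proof.
move=> x1; have x0 : 0 < 1 + x by rewrite addrC -ltrBlDr sub0r.
have inv1 : 1 + - (x / (1 + x)) = (1 + x)^-1 by field; rewrite gt_eqF.
rewrite -[leRHS]opprK lerNr -lnV ?posrE// -[X in ln X]inv1 le_ln1Dx//.
by rewrite -subr_gt0 opprK addrC inv1 invr_gt0.
Qed.

(** The expansion at the origin, where the value is 1, is assumed for [0 <= s] only: the given
    function agrees with its analytic extension only at nonnegative times. *)
Lemma dyadic_scaling_expR (R : realType) (f : R -> R -> R) (a b C r : R) :
  (forall t x, 0 <= t -> 0 < f t x) ->
  0 <= C -> 0 < r ->
  (forall s v h, 0 <= s -> `|s| <= h -> `|v| <= h -> h <= r ->
    `|f s v - 1 - (a * s + b * v)| <= C * h ^+ 2) ->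
  (forall t x, 0 < t -> f t x ^+ 2 = f (4 * t) (2 * x + t)) ->
  forall t x, 0 < t -> f t x = expR (b * x - b / 2 * t).
Proof.
move=> f0 C0 r0 taylor feq t x t0.
(* The point [(tn n, xn n)] is the [n]-th preimage of [(t, x)] under the scaling map: its time is
   [t / 4^n] and its coordinate [xn n - tn n / 2] is [u / 2^n]. *)
pose u := x - t / 2; pose k n : R := 2^-1 ^+ n.
pose tn n := t * k n ^+ 2; pose xn n := u * k n + t / 2 * k n ^+ 2.
pose y n := f (tn n) (xn n) - 1.
have k0 n : 0 < k n by rewrite exprn_gt0// invr_gt0.
have kS n : k n = 2 * k n.+1 by rewrite /k exprS; field.
have k1 n : k n <= 1 by rewrite exprn_ile1// ?invr_ge0// invf_le1// ler1n.
have cvgk : k @ \oo --> 0.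
  by apply: cvg_expr; rewrite gtr0_norm ?invr_gt0// invf_lt1// ltr1n.
have tn0 n : 0 < tn n by rewrite mulr_gt0// exprn_gt0.
have fy n : f (tn n) (xn n) = 1 + y n by rewrite /y addrC subrK.
have y1 n : -1 < y n by rewrite -subr_gt0 opprK addrC -fy f0// ltW.
have fS n : f (tn n) (xn n) = f (tn n.+1) (xn n.+1) ^+ 2.
  by rewrite feq// /tn /xn (kS n); congr f; field.
(* Each step towards the origin halves the logarithm, so the right-hand side does not depend on [n]
   and may be evaluated in the limit. *)
have lnf n : ln (f t x) = ln (1 + y n) / k n.
  elim: n => [|n ->]; rewrite -!fy.
    by rewrite /tn /xn /k expr0 expr1n divr1 !mulr1 /u subrK.
  rewrite fS lnXn ?f0 1?ltW// (kS n) -mulr_natl.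
  by field; rewrite gt_eqF.
(* The three terms of [D] come from the time part [a * tn n], from the quadratic part of [xn n], and
   from the Taylor remainder with [h = k n * (|u| + t)]. All are of order [k n ^+ 2], so one factor
   [k n] survives the division. *)
pose D := `|a| * t + `|b| * (t / 2) + C * (`|u| + t) ^+ 2.
have ybound : \forall n \near \oo, `|y n / k n - b * u| <= D * k n.
  have K0 : 0 < `|u| + t by rewrite ltr_wpDl.
  have : \forall n \near \oo, k n <= r / (`|u| + t).
    by apply: (cvgr_le _ cvgk); rewrite divr_gt0.
  apply: filterS => n; rewrite ler_pdivlMr// => kr.
  have k2 : k n ^+ 2 <= k n by rewrite expr2 ger_pMr.
  have tk2 : t * k n ^+ 2 <= t * k n by rewrite ler_wpM2l// ltW.
  have uk0 : 0 <= `|u| * k n by rewrite mulr_ge0// ltW.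
  have tk0 : 0 <= t * k n by rewrite mulr_ge0// ltW.
  have tnle : `|tn n| <= k n * (`|u| + t) by rewrite gtr0_norm// /tn; lra.
  have xnle : `|xn n| <= k n * (`|u| + t).
    rewrite /xn (le_trans (ler_normD _ _))// !normrM (gtr0_norm (k0 n)).
    rewrite (gtr0_norm t0) (@gtr0_norm _ 2^-1) ?invr_gt0//; lra.
  have := taylor _ _ _ (ltW (tn0 n)) tnle xnle kr; rewrite -/(y n) => Hy.
  rewrite [X in `|X|](_ : _ = ((y n - (a * tn n + b * xn n)) +
      (a * tn n + b * (t / 2) * k n ^+ 2)) / k n); last first.
    by rewrite /xn; field; rewrite gt_eqF.
  rewrite normrM normfV (gtr0_norm (k0 n)) ler_pdivrMr//.
  rewrite (le_trans (ler_normD _ _))//.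
  have : `|a * tn n + b * (t / 2) * k n ^+ 2| <=
      (`|a| * t + `|b| * (t / 2)) * k n ^+ 2.
    rewrite /tn (mulrA a) -mulrDl normrM (gtr0_norm (exprn_gt0 2 (k0 n))).
    rewrite ler_pM2r ?exprn_gt0// (le_trans (ler_normD _ _))// !normrM.
    by rewrite (gtr0_norm t0) (@gtr0_norm _ 2^-1) ?invr_gt0.
  rewrite /D; move: Hy; rewrite exprMn; nra.
have cvgyk : (fun n => y n / k n) @ \oo --> b * u.
  apply: (@squeeze_dist0 _ _ _ _ _ (fun n => D * k n) _ ybound).
  rewrite -(mulr0 D).
  by apply: cvgM => //; exact: cvg_cst.
have cvgy : y @ \oo --> 0.
  rewrite -(mul0r (b * u)) (_ : y = (fun n => k n * (y n / k n))).
    exact: cvgM.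
  by apply/funext => n; rewrite mulrC divfK// gt_eqF.
suff lnfE : ln (f t x) = b * u.
  rewrite -(lnK (f0 t x (ltW t0))) lnfE; congr expR.
  by rewrite /u; field.
have lo : (fun n => y n / k n / (1 + y n)) @ \oo --> b * u.
  have y1cvg : (fun n => 1 + y n) @ \oo --> (1 + 0 : R).
    by apply: cvgD => //; exact: cvg_cst.
  rewrite -[X in _ --> X]divr1 -{2}(addr0 1); apply: cvgM => //.
  by apply: cvgV y1cvg; rewrite addr0 oner_neq0.
(* The bounds [y / (1 + y) <= ln (1 + y) <= y], divided by [k n], enclose the constant [ln (f t x)]
   between two sequences with limit [b * u]. *)
apply/eqP; rewrite eq_le; apply/andP; split.
  apply: (cvgr_to_ge cvgyk); near=> n.
  by rewrite (lnf n) ler_pM2r ?invr_gt0// le_ln1Dx.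
apply: (cvgr_to_le lo); near=> n.
by rewrite (lnf n) mulrAC ler_pM2r ?invr_gt0// ge_ln1Dx.
Unshelve. all: by end_near.
Qed.

(** * From the Brownian identity to the closed half-plane *)

Theorem proposition1 (R : realType) (d : measure_display)
    (T : measurableType d) (P : probability T R)
    (W : R -> {RV P >-> R}) (hW : standard_brownian_motion P W)
    (f : R -> R -> R)
    (f_gt0 : forall t x : R, 0 <= t -> 0 < f t x)
    (f_analytic :
      analytic2_on [set p : R * R | 0 <= p.1] (fun p => f p.1 p.2))
    (f_eq : forall t : R, 0 <= t ->
      {ae P, forall w, f t (W t w) ^+ 2 = f (4 * t) (2 * W t w + t)}) :
  exists c : R, forall t x : R, 0 <= t -> f t x = expR (c * x - c / 2 * t).
Proof.
have [U [F [_ AU FU Ff]]] := f_analytic.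
(* At time 0 the identity reads [f 0 0 ^+ 2 = f 0 0] almost surely, hence at some sample point since
   [P] has mass 1; positivity excludes the root 0. *)
have f00 : f 0 0 = 1.
  have : {ae P, forall w, f 0 0 ^+ 2 = f 0 0}.
    have := f_eq 0 (lexx _); apply: filterS2 (bm_start hW) => w ->.
    by rewrite !mulr0 addr0.
  have PT : (0 < P [set: T])%E by rewrite probability_setT.
  case/(@filter_ex _ _ (ae_properfilter_algebraOfSetsType PT)) => w.
  rewrite expr2 -[RHS]mulr1; apply: mulfI.
  by rewrite gt_eqF// f_gt0.
(* The extension [F] is continuous in a full neighbourhood sense even at [t = 0], so limits of [f]
   along the half-plane can be computed through [F]. *)
have cF (t x : R) : 0 <= t -> F q @[q --> (t, x)] --> F (t, x).
  by move=> t0; apply: real_analytic2_continuous FU (AU _ _).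
have cf (t : R) : 0 <= t -> continuous (f t).
  move=> t0 x; rewrite (_ : f t = (fun y => F (t, y))); last first.
    by apply/funext => y; rewrite Ff.
  apply: (@cvg_comp _ _ _ (fun y => (t, y)) F _
    (filter_prod (nbhs t) (nbhs x))); last exact: cF.
  exact: (@cvg_pair _ _ _ _ _ _ _ _ _ (fun=> t) id (cvg_cst _) (@cvg_id _ _)).
have feq (t x : R) : 0 < t -> f t x ^+ 2 = f (4 * t) (2 * x + t).
  move=> t0; have t4 : 0 <= 4 * t by rewrite mulr_ge0// ltW.
  apply: (@brownian_ae_eq_continuous _ _ _ P W t (fun x => f t x ^+ 2)
    (fun x => f (4 * t) (2 * x + t))) => //; last by apply: f_eq; exact: ltW.
    by move=> y; exact: cvgM (cf _ (ltW t0) y) (cf _ (ltW t0) y).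
  move=> y; have aff : 2 * z + t @[z --> y] --> 2 * y + t.
    apply: cvgD; last exact: cvg_cst.
    by apply: cvgM; [exact: cvg_cst|exact: cvg_id].
  exact: (cvg_comp _ _ aff (cf _ t4 _)).
have [a [c [C [r [C0 r0 taylor]]]]] :=
  real_analytic2_taylor1 FU (AU (0, 0) (lexx _)).
have fpos (t x : R) : 0 < t -> f t x = expR (c * x - c / 2 * t).
  apply: (@dyadic_scaling_expR _ _ a c C r) => // s v h s0 sh vh hr.
  by have := taylor s v h sh vh hr; rewrite /= !add0r !Ff//= f00.
exists c => t x; rewrite le_eqVlt => /predU1P[<-|]; last exact: fpos.
(* At [t = 0] both sides are limits along the positive times [harmonic n], where the formula is
   already known. *)
have limf : (fun n => f (harmonic n) x) @ \oo --> f 0 x.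
  rewrite -(Ff (0, x))//= (_ : (fun n => _) = (fun n => F (harmonic n, x))).
    apply: (@cvg_comp _ _ _ (fun n => (harmonic n, x)) F _
      (filter_prod (nbhs 0) (nbhs x))); last exact: cF.
    exact: (@cvg_pair _ _ _ _ _ _ _ _ _ harmonic (fun=> x)
      cvg_harmonic (cvg_cst _)).
  by apply/funext => n; rewrite Ff//= ltW// harmonic_gt0.
have lime : (fun n => f (harmonic n) x) @ \oo --> expR (c * x - c / 2 * 0).
  under eq_fun do rewrite fpos ?harmonic_gt0//.
  apply: continuous_cvg; first exact: continuous_expR.
  apply: cvgB; first exact: cvg_cst.
  by apply: cvgM; [exact: cvg_cst|exact: cvg_harmonic].
by rewrite -(cvg_lim _ limf)// -(cvg_lim _ lime).
Qed.
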